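(* For all integers $L,M,a,b$ with $ab\geq 0$, and such that $|a|\leq M$ if $|b|\leq M$ and $|a+b|\leq L$, $$\sum_{i=0}^M q^{\frac12 i^2}\begin{bmatrix}L+M-i\\ L\end{bmatrix}\mathcal{T}(i,L-i,b,a)=q^{\frac12 b^2}\,\mathcal{S}(L,M,a+b,b).$$
   Context: The Gaussian polynomial is $\left[\begin{smallmatrix}m+n\\ m\end{smallmatrix}\right]=\prod_{k=1}^m\frac{1-q^{n+k}}{1-q^k}$ if $m,n\in\{0,1,2,\dots\}$ and $0$ otherwise. For integers $L,M,a,b$: $$\mathcal{T}(L,M,a,b)=\sum_{\substack{n=0\\ n+a+L\ \text{even}}}^{L} q^{\frac12 n^2}\begin{bmatrix}M\\ n\end{bmatrix}\begin{bmatrix}M+b+(L-a-n)/2\\ M+b\end{bmatrix}\begin{bmatrix}M-b+(L+a-n)/2\\ M-b\end{bmatrix},$$ $$\mathcal{S}(L,M,a,b)=\sum_{k=0}^L q^{k(k+a)}\begin{bmatrix}L+M-a-2k\\ M\end{bmatrix}\begin{bmatrix}M-a+b\\ k\end{bmatrix}\begin{bmatrix}M+a-b\\ k+a\end{bmatrix}$$ (empty sums are $0$). Identities are in the ring of polynomials in $q^{1/2}$. *)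

(* Defs.v *)
From HB Require Import structures.
From mathcomp Require Import all_boot all_order all_algebra.
From mathcomp Require Import fraction.
From mathcomp Require Import ring.
Set Implicit Arguments.
Unset Strict Implicit.
Unset Printing Implicit Defensive.

Import Order.TTheory GRing.Theory Num.Theory.
Local Open Scope ring_scope.

Local Notation "p %:F" := (@tofrac {poly int} p) : ring_scope.

(* Everything lives in the fraction field of Z[q^(1/2)]: quotients such as
   (1 - q^(n+k)) / (1 - q^k) and integer exponents can then be written as they
   stand, and polynomials embed injectively, so an equality of polynomials here
   is an equality in Z[q^(1/2)]. *)
Definition qfield : fieldType := {fraction {poly int}}.

Definition qhalf : qfield := ('X : {poly int})%:F.
Definition q : qfield := qhalf ^+ 2.

Definition gauss_prod (m n : nat) : qfield :=
  \prod_(1 <= k < m.+1) ((1 - q ^+ (n + k)) / (1 - q ^+ k)).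

(* gaussian N m is the Gaussian polynomial with top entry N and bottom entry m;
   the n of the product formula is N - m. *)
Definition gaussian (N m : int) : qfield :=
  match m, N - m with
  | Posz m', Posz n' => gauss_prod m' n'
  | _, _ => 0
  end.

(* \sum_(n = 0)^L F n for an integer bound L, empty when L < 0. *)
Definition sum0 (L : int) (F : int -> qfield) : qfield :=
  match L with
  | Posz l => \sum_(0 <= n < l.+1) F n%:Z
  | Negz _ => 0
  end.

(* Under the parity condition both divisions by 2 are exact. *)
Definition calT (L M a b : int) : qfield :=
  sum0 L (fun n =>
    if (2 %| n + a + L)%Z then
      qhalf ^ (n ^+ 2) * gaussian M n
        * gaussian (M + b + ((L - a - n) %/ 2)%Z) (M + b)
        * gaussian (M - b + ((L + a - n) %/ 2)%Z) (M - b)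
    else 0).

(* The exponent k (k + a) is negative only if k + a < 0, in which case the last
   factor is 0. *)
Definition calS (L M a b : int) : qfield :=
  sum0 L (fun k =>
    q ^ (k * (k + a)) * gaussian (L + M - a - k *+ 2) M
      * gaussian (M - a + b) k * gaussian (M + a - b) (k + a)).

Lemma one_sub_q_neq0 (k : nat) : 1 - q ^+ k.+1 != 0.
Proof.
rewrite /q /qhalf -exprM -tofracXn -tofrac1 -tofracB tofrac_eq0.
rewrite subr_eq0 eq_sym; apply/eqP => /(congr1 (size : {poly int} -> nat)).
by rewrite size_polyXn size_poly1 mul2n doubleS.
Qed.

Lemma gauss_prodS (m n : nat) :
  gauss_prod m.+1 n.+1 = gauss_prod m n.+1 + q ^+ m.+1 * gauss_prod m.+1 n.
Proof.
have nz := one_sub_q_neq0 m.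
have E1 : gauss_prod m.+1 n.+1
    = gauss_prod m n.+1 * ((1 - q ^+ (n.+1 + m.+1)) / (1 - q ^+ m.+1)).
  by rewrite /gauss_prod big_nat_recr.
have E2 : gauss_prod m.+1 n
    = gauss_prod m n.+1 * ((1 - q ^+ n.+1) / (1 - q ^+ m.+1)).
  rewrite /gauss_prod !big_split /= [X in _ * X = _]big_nat_recr //=.
  rewrite [X in X * _ = _]big_nat_recl // addn1.
  rewrite (eq_big_nat _ _ (F2 := fun k => 1 - q ^+ (n.+1 + k))); last first.
    by move=> i _; rewrite addnS addSn.
  by rewrite -!mulrA mulrC -!mulrA; congr (_ * (_ * _)); rewrite mulrC.
rewrite E1 E2 exprD.
rewrite [X in _ = _ + X]mulrCA -{2}[gauss_prod m n.+1]mulr1 -mulrDr; congr (_ * _).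
rewrite -[X in _ = X + _](divff nz) mulrA -mulrDl; congr (_ / _).
by ring.
Qed.

Lemma gaussian_poly (N m : int) : exists p : {poly int}, gaussian N m = p%:F.
Proof.
rewrite /gaussian; case: m => [m|m]; last by exists 0; rewrite tofrac0.
case: (N - _) => [n|n]; last by exists 0; rewrite tofrac0.
elim: m n => [|m IHm] n.
  by exists 1; rewrite /gauss_prod big_nil tofrac1.
elim: n => [|n [p2 IHn]].
  exists 1; rewrite /gauss_prod tofrac1 big_nat big1 // => -[|k] // _.
  by rewrite add0n divff // one_sub_q_neq0.
have [p1 IHp] := IHm n.+1.
exists (p1 + ('X ^+ 2) ^+ m.+1 * p2).
by rewrite gauss_prodS IHp IHn tofracD tofracM !tofracXn.
Qed.

(* Main.v *)
(* Write F(L,M,a,b) for the left-hand side and G(L,M,a,b) for the right-hand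
   side. Summing over r = (i-b-n)/2 instead of n, T(i,N,b,a) is the coefficient
   of z^i w^b in (-z q^(1/2);q)_N / ((z/w;q)_(N+a+1) (zw;q)_(N-a+1)), while
   q^((c^2-b^2)/2) G with c = a+b is the coefficient of x^L y^c in
   (-x q^(1/2)/y;q)_(M-a) (-x y q^(1/2);q)_(M+a) / (x;q)_(M+1). The elementary
   q-difference equations of these products show that F and G both satisfy
     q^(b-1/2) F(L,M,a+1,b-1) + q^(M+b) F(L-1,M,a+1,b)
       = F(L,M,a,b) + q^(M+1/2) F(L-1,M,a,b-1)      (a >= 0, b >= 1),
   which reduces the claim for a, b >= 0 to a = 0 by induction on a and L, and
   for a = 0 both satisfy
     F(L,M,b) - q^M F(L-1,M,b) = F(L,M-1,b) + q^(2M-1) F(L-2,M-1,b)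
       + q^(M-1/2) (F(L-1,M-1,b-1) + F(L-1,M-1,b+1)),
   which settles that case. Negative a, b follow from the symmetry
   (a,b) -> (-a,-b) of both sides. The restriction b >= 1 is where ab >= 0
   enters: T vanishes by convention for N < |a|, which breaks the q-difference
   equation at N = a, but only in coefficients of nonpositive powers of w. *)
Require Import Defs.
From mathcomp Require Import all_boot all_order all_algebra.
From mathcomp Require Import fraction.
From mathcomp Require Import ring zify.
Import Order.TTheory GRing.Theory Num.Theory.
Local Open Scope ring_scope.

Local Notation g := gaussian.
Local Notation h := qhalf.

Arguments gaussian : simpl never.
Arguments calT : simpl never.
Arguments calS : simpl never.

(** * Powers of q^(1/2) and the two q-Pascal rules *)

Lemma qhalf_neq0 : h != 0.
Proof. by rewrite tofrac_eq0 polyX_eq0. Qed.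

Lemma qhalfD (m n : int) : h ^ (m + n) = h ^ m * h ^ n.
Proof. exact: expfzDr qhalf_neq0. Qed.

Lemma q_exp (n : int) : q ^ n = h ^ (n *+ 2).
Proof. by rewrite /q -mulr_natl -exprz_exp. Qed.

Lemma q_expn (n : nat) : q ^+ n = h ^ (n%:Z *+ 2).
Proof. by rewrite -q_exp. Qed.

Lemma gauss_prodSl (m n : nat) :
  gauss_prod m.+1 n = gauss_prod m n * ((1 - q ^+ (n + m.+1)) / (1 - q ^+ m.+1)).
Proof. by rewrite /gauss_prod big_nat_recr. Qed.

Lemma gauss_prod_shift (m n : nat) :
  gauss_prod m n * (1 - q ^+ (n + m).+1) = gauss_prod m n.+1 * (1 - q ^+ n.+1).
Proof.
elim: m => [|m IHm]; first by rewrite /gauss_prod !big_nil addn0.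
by rewrite !gauss_prodSl addnS mulrA IHm addSn addnS; ring.
Qed.

Lemma gauss_prodS_top (m n : nat) :
  gauss_prod m.+1 n.+1 = gauss_prod m.+1 n + q ^+ n.+1 * gauss_prod m n.+1.
Proof.
(* The two q-Pascal rules differ exactly by this absorption identity. *)
have E : gauss_prod m.+1 n * (1 - q ^+ m.+1) = gauss_prod m n.+1 * (1 - q ^+ n.+1).
  by rewrite gauss_prodSl -gauss_prod_shift addnS mulrA divfK ?one_sub_q_neq0.
apply/eqP; rewrite gauss_prodS -subr_eq0; apply/eqP.
transitivity (gauss_prod m n.+1 * (1 - q ^+ n.+1) - gauss_prod m.+1 n * (1 - q ^+ m.+1)); first by ring.
by rewrite E subrr.
Qed.

Lemma gaussianE (m n : nat) : g (m + n)%N%:Z m%:Z = gauss_prod m n.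
Proof. by rewrite /gaussian (_ : (m + n)%N%:Z - m%:Z = n%:Z); last lia. Qed.

Lemma gaussian_eq0 (N m : int) : (m < 0) || (N < m) -> g N m = 0.
Proof.
rewrite /gaussian; case: m => // m /=.
by case E: (N - m%:Z) => [n|//] H; exfalso; lia.
Qed.

Lemma gaussian0 (N : int) : 0 <= N -> g N 0 = 1.
Proof. by case: N => // n _; rewrite (gaussianE 0 n) /gauss_prod big_nil. Qed.

Lemma gaussianNN (N : int) : 0 <= N -> g N N = 1.
Proof.
case: N => // n _; rewrite -{1}[n]addn0 gaussianE /gauss_prod big_nat big1 // => -[|k] // _.
by rewrite add0n divff // one_sub_q_neq0.
Qed.

(** With the zero conventions the rule fails only at N = m = 0, where the left side is 1 and both
    terms on the right vanish. Later side conditions exist to avoid this exception. *)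
Lemma gaussian_pascal (N m : int) : (N != 0) || (m != 0) ->
  g N m = g (N - 1) (m - 1) + h ^ (m *+ 2) * g (N - 1) m.
Proof.
move=> nz; have [m_neg|m_ge0] := ltP m 0; first by rewrite !gaussian_eq0 ?mulr0 ?addr0 //; lia.
have [Nm|mN] := ltP N m; first by rewrite !gaussian_eq0 ?mulr0 ?addr0 //; lia.
case: m => [[|m]|//] in m_ge0 nz mN *.
  by rewrite !gaussian0 ?gaussian_eq0 ?mul0rn ?expr0z ?mulr1 ?add0r //; lia.
have [->|Nm] := eqVneq N m.+1%:Z.
  by rewrite !gaussianNN ?gaussian_eq0 ?mulr0 ?addr0 //; lia.
have [n ->] : exists n : nat, N = (m.+1 + n.+1)%N%:Z by exists (`|N| - m.+2)%N; lia.
rewrite gaussianE gauss_prodS q_expn -!gaussianE.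
by congr (g _ _ + _ * g _ _); lia.
Qed.

Lemma gaussian_pascal_top (N m : int) : (N != 0) || (m != 0) ->
  g N m = h ^ ((N - m) *+ 2) * g (N - 1) (m - 1) + g (N - 1) m.
Proof.
move=> nz; have [m_neg|m_ge0] := ltP m 0; first by rewrite !gaussian_eq0 ?mulr0 ?addr0 //; lia.
have [Nm|mN] := ltP N m; first by rewrite !gaussian_eq0 ?mulr0 ?addr0 //; lia.
case: m => [[|m]|//] in m_ge0 nz mN *.
  by rewrite !gaussian0 ?gaussian_eq0 ?mulr0 ?add0r //; lia.
have [->|Nm] := eqVneq N m.+1%:Z.
  by rewrite subrr mul0rn expr0z mul1r !gaussianNN ?gaussian_eq0 ?addr0 //; lia.
have [n ->] : exists n : nat, N = (m.+1 + n.+1)%N%:Z by exists (`|N| - m.+2)%N; lia.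
rewrite gaussianE gauss_prodS_top q_expn addrC -!gaussianE.
by congr (h ^ _ * g _ _ + g _ _); lia.
Qed.

(** * Coefficients of 1 / (z;q)_(n+1), index shifts, and T as a sum over r *)

(* The coefficient of z^r in 1 / (z;q)_(n+1). *)
Definition cg (r n : int) : qfield := g (n + r) n.

Lemma cg_eq0 (r n : int) : (r < 0) || (n < 0) -> cg r n = 0.
Proof. by move=> H; rewrite /cg gaussian_eq0 //; lia. Qed.

(** Compare coefficients of z^r in (1 - z) / (z;q)_(n+1) = 1 / (zq;q)_n. The case r = n = 0 is lost
    because [cg 0 (-1)] is 0 by convention, whereas the empty product has constant term 1. *)
Lemma cg_pascal (r n : int) : (r != 0) || (n != 0) ->
  cg r n = cg (r - 1) n + h ^ (r *+ 2) * cg r (n - 1).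
Proof.
move=> nz; have [r_neg|r_ge0] := ltP r 0; first by rewrite !cg_eq0 ?mulr0 ?addr0 //; lia.
have [n_neg|n_ge0] := ltP n 0; first by rewrite !cg_eq0 ?mulr0 ?addr0 //; lia.
rewrite /cg gaussian_pascal_top ?addrK; last lia.
by rewrite addrC; congr (g _ _ + _ ^ (_ *+ 2) * g _ _); lia.
Qed.

(** Summation ranges are always taken wide enough for the end terms to vanish. A shift of the index
    then does the work of multiplying a generating function by a variable. *)
Lemma sum_shift (K : nat) (f : int -> qfield) : f (-1) = 0 -> f K%:Z = 0 ->
  \sum_(0 <= k < K.+1) f (k%:Z - 1) = \sum_(0 <= k < K.+1) f k%:Z.
Proof.
move=> f0 fK; rewrite big_nat_recl // f0 add0r big_nat_recr //= fK addr0.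
by apply: eq_bigr => k _; congr f; lia.
Qed.

Lemma sum0_extend (L : int) (K : nat) (f : int -> qfield) : L < K%:Z ->
  (forall n : nat, L < n%:Z -> f n%:Z = 0) -> sum0 L f = \sum_(0 <= n < K) f n%:Z.
Proof.
move=> LK f0; case: L LK f0 => [l|l] LK f0 /=; last first.
  by rewrite big1 // => n _; apply: f0.
rewrite [RHS](big_cat_nat (n := l.+1)) //=.
rewrite [X in _ + X]big_nat [X in _ + X]big1 ?addr0 // => n Hn.
by apply: f0; lia.
Qed.

(* Here r = (i - b - n) / 2, so that the parity condition of calT disappears. *)
Definition calT_term (i N b a r : int) : qfield :=
  h ^ ((i - r *+ 2 - b) ^+ 2) * g N (i - r *+ 2 - b) * cg r (N + a) * cg (r + b) (N - a).

Lemma calT_term_eq0 (i N b a r : int) :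
  [|| r < 0, r + b < 0, i - r *+ 2 - b < 0, i < r, N + a < 0 | N - a < 0] ->
  calT_term i N b a r = 0.
Proof.
move=> H; rewrite /calT_term.
have [Hr|Hr] := boolP ((r < 0) || (N + a < 0)); first by rewrite (cg_eq0 r) // mulr0 mul0r.
have [Hs|Hs] := boolP ((r + b < 0) || (N - a < 0)); first by rewrite (cg_eq0 (r + b)) // mulr0.
by rewrite (gaussian_eq0 N) ?mulr0 ?mul0r //; lia.
Qed.

Lemma calTE (i N b a : int) (K : nat) : i < K%:Z ->
  calT i N b a = \sum_(0 <= r < K) calT_term i N b a r%:Z.
Proof.
move=> iK; pose S := (K + `|i| + `|b|).+1.
(* The indicator of n + 2r + b = i turns both sums into one double sum, which collapses along r for
   given n and along n for given r. The bound [S] is large enough for both indices. *)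
pose G (n r : int) := if n == i - r *+ 2 - b then calT_term i N b a r else 0.
transitivity (\sum_(0 <= n < S) \sum_(0 <= r < S) G n%:Z r%:Z).
  rewrite /calT (@sum0_extend _ S); first last.
  (* The halves (i - b - n)/2 and (i + b - n)/2 add up to i - n < 0, so one of them is negative and
     its Gaussian polynomial vanishes. *)
  - move=> n Hn; case: ifP => // even; have [Hr|Hr] := ltP ((i - b - n%:Z) %/ 2)%Z 0.
      by rewrite [X in _ * X * _]gaussian_eq0 ?mulr0 ?mul0r //; lia.
    by rewrite [X in _ * X]gaussian_eq0 ?mulr0 //; lia.
  - by rewrite /S; lia.
    apply: eq_bigr => n _; case: ifP => even; last first.
      rewrite big1 // => r _; rewrite /G; case: eqP => // E.
      by exfalso; move/negP: even; apply; apply/dvdzP; exists (i - r%:Z); lia.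
    pose r0 := ((i - b - n%:Z) %/ 2)%Z.
    have E1 : i - b - n%:Z = r0 *+ 2 by rewrite /r0; lia.
    have E2 : ((i + b - n%:Z) %/ 2)%Z = r0 + b by lia.
    rewrite E2 -/r0.
    have -> : h ^ (n%:Z ^+ 2) * g N n%:Z * g (N + a + r0) (N + a) * g (N - a + (r0 + b)) (N - a)
       = calT_term i N b a r0.
      by rewrite /calT_term /cg (_ : i - r0 *+ 2 - b = n%:Z); last lia.
    have [r0_neg|r0_ge0] := ltP r0 0.
      rewrite calT_term_eq0 ?r0_neg // big1 // => r _; rewrite /G; case: eqP => // E.
      by exfalso; lia.
    rewrite (bigD1_seq `|r0|%N) ?iota_uniq ?mem_index_iota /= /G; [|rewrite /S; lia | done].
    rewrite -[X in X = _]addr0; congr (_ + _).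
      by rewrite gez0_abs // ifT //; lia.
    by rewrite big1 // => r Hr; case: eqP => // E; exfalso; lia.
rewrite exchange_big_nat /=.
rewrite (@big_cat_nat _ _ _ K) //=; last by rewrite /S; lia.
rewrite [X in _ + X]big_nat [X in _ + X]big1 ?addr0 => [|r Hr]; last first.
  rewrite big1 // => n _; rewrite /G; case: eqP => // E.
  by rewrite calT_term_eq0 //; lia.
apply: eq_big_nat => r Hr.
have [out|/norP[]] := boolP ((i - r%:Z *+ 2 - b < 0) || (i - r%:Z *+ 2 - b >= S%:Z)).
  rewrite calT_term_eq0; last by rewrite /S in out; lia.
  by rewrite big_nat big1 // => n Hn; rewrite /G; case: eqP => // E; exfalso; lia.
move=> n_ge n_lt; pose n0 := i - r%:Z *+ 2 - b.
rewrite (bigD1_seq `|n0|%N) ?iota_uniq ?mem_index_iota /= /G /n0; [ | lia | done].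
rewrite -[X in _ = X]addr0; congr (_ + _); first by rewrite ifT //; lia.
by rewrite big1 // => n Hn; case: eqP => // E; exfalso; lia.
Qed.

(** * Recurrences for T *)

Lemma calT_rec_a0_term (n N r s : int) : (N != 0) || (n + r + s != 0) ->
  g N n * (cg r N - cg (r - 1) N) * (cg s N - cg (s - 1) N)
  = h ^ (r *+ 2) * h ^ (s *+ 2) * (h ^ (n *+ 2) * g (N - 1) n + g (N - 1) (n - 1))
    * cg r (N - 1) * cg s (N - 1).
Proof.
have [->|N0] := eqVneq N 0 => H.
  have cgN x : cg x (0 - 1) = 0 by rewrite cg_eq0 //; lia.
  rewrite !cgN !mulr0.
  have [n0|n0] := eqVneq n 0; last by rewrite gaussian_eq0 ?mul0r //; lia.
  have [r0|r0] := eqVneq r 0.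
    rewrite (cg_pascal s) ?cgN; last lia.
    by ring.
  by rewrite (cg_pascal r) ?cgN ?r0 //; ring.
have Nn0 (x : int) : (x != 0) || (N != 0) by rewrite N0 orbT.
rewrite (cg_pascal r N (Nn0 _)) (cg_pascal s N (Nn0 _)) (gaussian_pascal N n); last lia.
by ring.
Qed.

(** Let Phi_N(z,w) generate T(i,N,b,0) as in the overview. This is the coefficient of z^i w^b in (1
    - zw)(1 - z/w) Phi_N(z,w) = (1 + z q^(1/2)) Phi_(N-1)(qz,w). *)
Lemma calT_rec_a0 (i N b : int) : (N != 0) || (i != 0) ->
  calT i N b 0 - calT (i - 1) N (b - 1) 0 - (calT (i - 1) N (b + 1) 0 - calT (i - 2) N b 0)
  = h ^ (i *+ 2) * calT i (N - 1) b 0 + h ^ (i *+ 2 - 1) * calT (i - 1) (N - 1) b 0.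
Proof.
move=> nz; pose K := (`|i| + 2)%N.
rewrite !(@calTE _ _ _ _ K.+1); try (rewrite /K; lia).
(* The index r counts powers of z/w, so exactly the two terms carrying the factor z/w are
   shifted. *)
pose f r := calT_term (i - 1) N (b + 1) 0 r - calT_term (i - 2) N b 0 r.
have shift_f : \sum_(0 <= r < K.+1) calT_term (i - 1) N (b + 1) 0 r%:Z
    - \sum_(0 <= r < K.+1) calT_term (i - 2) N b 0 r%:Z = \sum_(0 <= r < K.+1) f (r%:Z - 1).
  rewrite sum_shift ?sumrB // /f !calT_term_eq0 ?subrr //; rewrite /K; lia.
rewrite shift_f -!sumrB !mulr_sumr -big_split; apply: eq_bigr => /= r _.
rewrite /f /calT_term !addr0 ?subr0.
pose n := i - r%:Z *+ 2 - b; pose s := r%:Z + b.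
rewrite (_ : i - 1 - r%:Z *+ 2 - (b - 1) = n); last by rewrite /n; lia.
rewrite (_ : i - 1 - (r%:Z - 1) *+ 2 - (b + 1) = n); last by rewrite /n; lia.
rewrite (_ : i - 2 - (r%:Z - 1) *+ 2 - b = n); last by rewrite /n; lia.
rewrite (_ : i - 1 - r%:Z *+ 2 - b = n - 1); last by rewrite /n; lia.
rewrite (_ : r%:Z - 1 + (b + 1) = s); last by rewrite /s; lia.
rewrite (_ : r%:Z - 1 + b = s - 1); last by rewrite /s; lia.
rewrite (_ : r%:Z + (b - 1) = s - 1); last by rewrite /s; lia.
rewrite -/n -/s.
transitivity (h ^ (n ^+ 2) * (g N n * (cg r N - cg (r%:Z - 1) N) * (cg s N - cg (s - 1) N))).
  by ring.
rewrite calT_rec_a0_term; last by rewrite /n /s; lia.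
have -> : h ^ (i *+ 2) = h ^ (r%:Z *+ 2) * h ^ (s *+ 2) * h ^ (n *+ 2).
  by rewrite -!qhalfD; congr (_ ^ _); rewrite /n /s; lia.
have -> : h ^ (i *+ 2 - 1) * (h ^ ((n - 1) ^+ 2) * g (N - 1) (n - 1) * cg r (N - 1) * cg s (N - 1))
  = h ^ (n ^+ 2) * h ^ (r%:Z *+ 2) * h ^ (s *+ 2) * g (N - 1) (n - 1) * cg r (N - 1) * cg s (N - 1).
  rewrite !mulrA -!qhalfD; congr (h ^ _ * _ * _ * _); rewrite /n /s; ring.
ring.
Qed.

(** This is the summand of [calT_step_a], where n, r, s are the exponents of z, z/w and zw. The
    terms do not cancel individually: the right side is a difference that telescopes in r. The bound
    s >= 1, which comes from b >= 1, keeps [cg_pascal] in s away from its exception. *)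
Lemma calT_step_a_term (n N a : int) (r s : int) : 0 <= a -> 1 <= s ->
  let U := N + a in let V := N - a - 1 in
  h ^ ((s - r) *+ 2 - 1) * (h ^ ((n + 1) ^+ 2) * g N (n + 1) * cg r (U + 1) * cg (s - 1) V
      - h ^ ((n + 1) ^+ 2) * g N (n + 1) * cg (r - 1) (U + 1) * cg (s - 1) V)
  - (h ^ (n ^+ 2) * g N n * cg r U * cg s (N - a) - h ^ (n ^+ 2) * g N n * cg r U * cg (s - 1) (N - a))
  + h ^ ((n + r + s) *+ 2) * (h ^ ((s - r) *+ 2) * (h ^ (n ^+ 2) * g (N - 1) n * cg r U * cg s (V - 1))
      - h * (h ^ ((n + 1) ^+ 2) * g (N - 1) (n + 1) * cg r (U - 1) * cg (s - 1) V))
  = h ^ ((n + 2) ^+ 2 + (s - 1) *+ 2) * g (N - 1) (n + 1) * cg (r - 1) U * cg (s - 1) V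
    - h ^ (n ^+ 2 + s *+ 2) * g (N - 1) (n - 1) * cg r U * cg s V.
Proof.
move=> a0 s1 /=; set U := N + a; set V := N - a - 1.
have -> : cg s (N - a) = cg (s - 1) (N - a) + h ^ (s *+ 2) * cg s V.
  by rewrite cg_pascal //; lia.
(* For V < 0 everything left after this expansion contains a vanishing [cg] factor. Otherwise N >= a
   + 1 >= 1, so the remaining Pascal rules apply. *)
have [V_neg|V_ge0] := ltP V 0.
  by rewrite !(cg_eq0 _ V) ?(cg_eq0 _ (V - 1)); try lia; ring.
have U1 : U != 0 by lia.
have pU1 : cg r (U + 1) = cg (r - 1) (U + 1) + h ^ (r *+ 2) * cg r U.
  by rewrite cg_pascal ?addrK //; lia.
have pU : h ^ (r *+ 2) * cg r (U - 1) = cg r U - cg (r - 1) U.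
  by rewrite (cg_pascal r U) ?U1 ?orbT; first ring.
have pV : h ^ (s *+ 2) * cg s (V - 1) = cg s V - cg (s - 1) V.
  by rewrite (cg_pascal s V); [ring | lia].
have pn : g N n = g (N - 1) (n - 1) + h ^ (n *+ 2) * g (N - 1) n.
  by rewrite gaussian_pascal //; lia.
have pn1 : g N (n + 1) = g (N - 1) n + h ^ (n *+ 2 + 2) * g (N - 1) (n + 1).
  rewrite (gaussian_pascal N (n + 1)) ?addrK; last lia.
  by congr (_ + h ^ _ * _); lia.
(* The common factor q^(n^2/2 + s) is taken out, with powers left over where the Pascal rules [pU]
   and [pV] need them. *)
transitivity (h ^ (n ^+ 2 + s *+ 2) * (h ^ (n *+ 2) * g N (n + 1) * cg r U * cg (s - 1) V
   - g N n * cg r U * cg s V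
   + h ^ (n *+ 2) * g (N - 1) n * cg r U * (h ^ (s *+ 2) * cg s (V - 1))
   - h ^ (n *+ 4 + 2) * g (N - 1) (n + 1) * (h ^ (r *+ 2) * cg r (U - 1)) * cg (s - 1) V)).
  rewrite pU1.
  have e1 : h ^ ((s - r) *+ 2 - 1) * h ^ ((n + 1) ^+ 2) * h ^ (r *+ 2) = h ^ (n ^+ 2 + s *+ 2) * h ^ (n *+ 2).
    by rewrite -!qhalfD; congr (h ^ _); ring.
  have e2 : h ^ ((n + r + s) *+ 2) * h ^ ((s - r) *+ 2) * h ^ (n ^+ 2) = h ^ (n ^+ 2 + s *+ 2) * h ^ (n *+ 2) * h ^ (s *+ 2).
    by rewrite -!qhalfD; congr (h ^ _); ring.
  have e3 : h ^ ((n + r + s) *+ 2) * h * h ^ ((n + 1) ^+ 2) = h ^ (n ^+ 2 + s *+ 2) * h ^ (n *+ 4 + 2) * h ^ (r *+ 2).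
    by rewrite -[h in _ * h * _]expr1z -!qhalfD; congr (h ^ _); ring.
  have e4 : h ^ (n ^+ 2 + s *+ 2) = h ^ (n ^+ 2) * h ^ (s *+ 2) by rewrite qhalfD.
  rewrite !mulrBr !mulrDr !mulrA e2 e3.
  transitivity ((h ^ ((s - r) *+ 2 - 1) * h ^ ((n + 1) ^+ 2) * h ^ (r *+ 2)) * g N (n + 1) * cg r U * cg (s - 1) V
     - h ^ (n ^+ 2) * h ^ (s *+ 2) * g N n * cg r U * cg s V
     + h ^ (n ^+ 2 + s *+ 2) * h ^ (n *+ 2) * h ^ (s *+ 2) * g (N - 1) n * cg r U * cg s (V - 1)
     - h ^ (n ^+ 2 + s *+ 2) * h ^ (n *+ 4 + 2) * h ^ (r *+ 2) * g (N - 1) (n + 1) * cg r (U - 1) * cg (s - 1) V); first by ring.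
  rewrite e1 -e4; ring.
rewrite pU pV pn pn1.
have -> : h ^ ((n + 2) ^+ 2 + (s - 1) *+ 2) = h ^ (n ^+ 2 + s *+ 2) * h ^ (n *+ 4 + 2).
  by rewrite -!qhalfD; congr (h ^ _); ring.
have -> : h ^ (n *+ 4 + 2) = h ^ (n *+ 2) * h ^ (n *+ 2 + 2).
  by rewrite -!qhalfD; congr (h ^ _); ring.
ring.
Qed.

(** In generating functions the four groups of terms are multiples of (-z q^(3/2);q)_(N-1) /
    ((z/w;q)_(N+a+1) (qzw;q)_(N-a)). The cofactors are q^(1/2) w (1 + z q^(1/2)), -(1 + z q^(1/2)),
    1 - qzw and q^(1/2) (z - w), and they add up to 0. *)
Lemma calT_step_a (i N b a : int) : 0 <= a -> 1 <= b ->
  h ^ (b *+ 2 - 1) * (calT i N (b - 1) (a + 1) - calT (i - 1) N b (a + 1))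
  - (calT i N b a - calT (i - 1) N (b - 1) a)
  + h ^ (i *+ 2) * (h ^ (b *+ 2) * calT i (N - 1) b (a + 1) - h * calT i (N - 1) (b - 1) a) = 0.
Proof.
move=> a0 b1; pose K := (`|i| + 2)%N.
rewrite !(@calTE _ _ _ _ K.+1); try (rewrite /K; lia).
(* The summands of the relation add up to E (r - 1) - E r. *)
pose E r := h ^ ((i - r *+ 2 - b) ^+ 2 + (r + b) *+ 2) * g (N - 1) (i - r *+ 2 - b - 1)
   * cg r (N + a) * cg (r + b) (N - a - 1).
have shiftT : \sum_(0 <= r < K.+1) calT_term (i - 1) N b (a + 1) r%:Z
   = \sum_(0 <= r < K.+1) calT_term (i - 1) N b (a + 1) (r%:Z - 1).
  by rewrite sum_shift // calT_term_eq0 //; rewrite /K; lia.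
have telescope : \sum_(0 <= r < K.+1) (E (r%:Z - 1) - E r%:Z) = 0.
  rewrite sumrB sum_shift ?subrr // /E.
    by rewrite (cg_eq0 (-1)) // mulr0 mul0r.
  by rewrite (gaussian_eq0 _ (_ - 1)) ?mulr0 ?mul0r //; rewrite /K; lia.
rewrite shiftT -[RHS]telescope -!sumrB !mulr_sumr -!sumrB !mulr_sumr -big_split.
apply: eq_bigr => /= r _.
pose n := i - r%:Z *+ 2 - b; pose s := r%:Z + b.
rewrite /E /calT_term.
rewrite (_ : i - 1 - (r%:Z - 1) *+ 2 - b = n + 1); last by rewrite /n; lia.
rewrite (_ : i - r%:Z *+ 2 - (b - 1) = n + 1); last by rewrite /n; lia.
rewrite (_ : i - 1 - r%:Z *+ 2 - (b - 1) = n); last by rewrite /n; lia.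
rewrite (_ : i - (r%:Z - 1) *+ 2 - b - 1 = n + 1); last by rewrite /n; lia.
rewrite (_ : i - (r%:Z - 1) *+ 2 - b = n + 2); last by rewrite /n; lia.
rewrite (_ : r%:Z - 1 + b = s - 1); last by rewrite /s; lia.
rewrite (_ : r%:Z + (b - 1) = s - 1); last by rewrite /s; lia.
rewrite (_ : N - 1 + (a + 1) = N + a); last by lia.
rewrite (_ : N - 1 - (a + 1) = N - a - 1 - 1); last by lia.
rewrite (_ : N - (a + 1) = N - a - 1); last by lia.
rewrite (_ : N - 1 + a = N + a - 1); last by lia.
rewrite (_ : N - 1 - a = N - a - 1); last by lia.
rewrite (addrA N a 1) -/n -/s.
have s1 : 1 <= s by rewrite /s; lia.
rewrite (_ : i = n + r%:Z + s); last by rewrite /n /s; lia.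
rewrite (_ : b = s - r%:Z); last by rewrite /s; lia.
move: n s s1 => {E telescope shiftT} n s s1.
rewrite calT_step_a_term //.
Qed.

Lemma calT_eq0 (i N b a : int) :
  [|| i < 0, i < b, i < - b, N + a < 0 | N - a < 0] -> calT i N b a = 0.
Proof.
move=> H; rewrite (@calTE _ _ _ _ (`|i|).+1); last lia.
rewrite big_nat big1 // => r Hr; rewrite calT_term_eq0 //.
move: H; case: ltP => //= i0; lia.
Qed.

(** * Recurrences for the left-hand side *)

Definition calF (L M a b : int) : qfield :=
  sum0 M (fun i => h ^ (i ^+ 2) * g (L + M - i) L * calT i (L - i) b a).

Lemma calFE (L M a b : int) (K : nat) : M < K%:Z ->
  calF L M a b
  = \sum_(0 <= i < K) h ^ (i%:Z ^+ 2) * g (L + M - i%:Z) L * calT i%:Z (L - i%:Z) b a.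
Proof.
move=> MK; rewrite /calF (@sum0_extend _ K) // => n Hn.
by rewrite gaussian_eq0 ?mulr0 ?mul0r //; lia.
Qed.

(** With L - 1 for L, the second index of [calT] becomes L - i again, so sums for L and L - 1 can be
    compared term by term. *)
Lemma calF_shift (L M a b : int) (K : nat) : M < K%:Z ->
  calF L M a b = \sum_(0 <= i < K.+1)
    h ^ ((i%:Z - 1) ^+ 2) * g (L + M + 1 - i%:Z) L * calT (i%:Z - 1) (L + 1 - i%:Z) b a.
Proof.
move=> MK.
pose f i := h ^ (i ^+ 2) * g (L + M - i) L * calT i (L - i) b a.
rewrite (@calFE _ _ _ _ K.+1); last lia.
rewrite -(@sum_shift K f); first last.
- by rewrite /f gaussian_eq0 ?mulr0 ?mul0r //; lia.
- by rewrite /f calT_eq0 ?mulr0.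
apply: eq_bigr => i _; rewrite /f.
by congr (_ * g _ _ * calT _ _ _ _); lia.
Qed.

(** Sum [calT_step_a] at N = L - i with weights q^(i^2/2) [L+M-i, L]. A Pascal rule for the weights
    produces the terms with L - 1, and the rest telescopes. *)
Lemma calF_step_a (L M a b : int) : 0 <= a -> 1 <= b -> 1 <= L -> 
  h ^ (b *+ 2 - 1) * calF L M (a + 1) (b - 1) + h ^ (M *+ 2 + b *+ 2) * calF (L - 1) M (a + 1) b
  = calF L M a b + h ^ (M *+ 2 + 1) * calF (L - 1) M a (b - 1).
Proof.
move=> a0 b1 L1; pose K := `|M|.+1.
rewrite !(@calFE L _ _ _ K.+1); try (rewrite /K; lia).
rewrite !(@calF_shift (L - 1) _ _ _ K); try (rewrite /K; lia).
(* In this notation [calT_step_a] says that q^(b-1/2) T(i,L-i,b-1,a+1) - T(i,L-i,b,a) = X(i) -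
   q^(i+1/2) X(i+1). *)
pose X i := h ^ (b *+ 2 - 1) * calT (i - 1) (L - i) b (a + 1) - calT (i - 1) (L - i) (b - 1) a.
pose Y i := h ^ (i ^+ 2) * g (L + M - (i - 1)) L * X i.
have telescope : \sum_(0 <= i < K.+1) (Y i%:Z - Y (i%:Z + 1)) = 0.
  pose Z i := Y (i + 1).
  have -> : \sum_(0 <= i < K.+1) (Y i%:Z - Y (i%:Z + 1)) = \sum_(0 <= i < K.+1) (Z (i%:Z - 1) - Z i%:Z).
    by apply: eq_bigr => i _; rewrite /Z subrK.
  rewrite sumrB sum_shift ?subrr // /Z /Y.
    by rewrite /X !calT_eq0 ?mulr0 ?subrr ?mulr0.
  by rewrite (gaussian_eq0 (_ + _ - _)) ?mulr0 ?mul0r //; rewrite /K; lia.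
apply/eqP; rewrite -subr_eq0; apply/eqP; rewrite -[RHS]telescope.
rewrite !mulr_sumr -!big_split -sumrB; apply: eq_bigr => /= n _.
move: n%:Z => i.
have pG : g (L + M - (i - 1)) L = h ^ ((M - i + 1) *+ 2) * g (L + M - i) (L - 1) + g (L + M - i) L.
  by rewrite gaussian_pascal_top; [congr (h ^ _ * g _ _ + g _ _); lia | lia].
rewrite (_ : L - 1 + M + 1 - i = L + M - i); last lia.
rewrite subrK.
rewrite /Y pG addrK.
have e1 : h ^ (M *+ 2 + b *+ 2) * h ^ ((i - 1) ^+ 2) = h ^ (i ^+ 2) * h ^ ((M - i + 1) *+ 2) * h ^ (b *+ 2 - 1).
  by rewrite -!qhalfD; congr (h ^ _); ring.
have e2 : h ^ (M *+ 2 + 1) * h ^ ((i - 1) ^+ 2) = h ^ (i ^+ 2) * h ^ ((M - i + 1) *+ 2).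
  by rewrite -!qhalfD; congr (h ^ _); ring.
have e3 : h ^ ((i + 1) ^+ 2) = h ^ (i ^+ 2) * h ^ (i *+ 2) * h.
  by rewrite -[X in _ = _ * X]expr1z -!qhalfD; congr (h ^ _); ring.
have e4 : h ^ (b *+ 2) = h ^ (b *+ 2 - 1) * h.
  by rewrite -[X in _ = _ * X]expr1z -!qhalfD; congr (h ^ _); ring.
rewrite !mulrA e1 e2 e3 /X addrK.
rewrite (_ : L - (i + 1) = L - i - 1); last lia.
have := calT_step_a i (L - i) b a a0 b1; rewrite e4 => rT.
apply/eqP; rewrite -subr_eq0; apply/eqP.
transitivity (h ^ (i ^+ 2) * g (L + M - i) L * 0); last by rewrite mulr0.
rewrite -[X in _ = _ * X]rT; ring.
Qed.

(** Sum [calT_rec_a0] at N = L - i with weights q^(i^2/2 + M - i) [L+M-1-i, L-1]. The Gaussian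
    factor arises as the difference between the weights for M and M - 1 on the left. *)
Lemma calF_rec_a0 (L M b : int) : 1 <= L -> 1 <= M ->
  calF L M 0 b - calF L (M - 1) 0 b - h ^ (M *+ 2) * calF (L - 1) M 0 b
  = h ^ (M *+ 2 - 1) * (calF (L - 1) (M - 1) 0 (b - 1) + calF (L - 1) (M - 1) 0 (b + 1))
    + h ^ (M *+ 4 - 2) * calF (L - 2) (M - 1) 0 b.
Proof.
move=> L1 M1; pose K := `|M|.+1.
rewrite !(@calFE L _ _ _ K.+1); try (rewrite /K; lia).
rewrite !(@calFE (L - 1) M _ _ K.+1); try (rewrite /K; lia).
rewrite !(@calF_shift (L - 1) (M - 1) _ _ K); try (rewrite /K; lia).
rewrite !(@calFE (L - 2) _ _ _ K.+1); try (rewrite /K; lia).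
pose P i := g (L + M - 1 - i) (L - 1).
have P_out i : M < i -> P i = 0 by move=> ?; rewrite /P gaussian_eq0 //; lia.
(* [A] and [B] collect the two terms of [calT_rec_a0] that match no sum with L or L - 1. Shifted by
   one and by two they carry the same T, and a Pascal rule for [P] merges them into the sum for L -
   2. *)
pose A i := h ^ (i ^+ 2 + M *+ 2 - 1) * P i * calT (i - 1) (L - 1 - i) b 0.
pose B i := h ^ (i ^+ 2 + M *+ 2 - i *+ 2) * P i * calT (i - 2) (L - i) b 0.
have ABC : \sum_(0 <= i < K.+1) (A i%:Z - B i%:Z) = h ^ (M *+ 4 - 2) *
   \sum_(0 <= i < K.+1) h ^ (i%:Z ^+ 2) * g (L - 2 + (M - 1) - i%:Z) (L - 2) * calT i%:Z (L - 2 - i%:Z) b 0.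
  pose A' i := A (i + 1); pose B' i := B (i + 1); pose B'' i := B' (i + 1).
  have shiftA : \sum_(0 <= i < K.+1) A i%:Z = \sum_(0 <= i < K.+1) A' i%:Z.
    rewrite -(@sum_shift K A').
    - by apply: eq_bigr => i _; rewrite /A' subrK.
    - by rewrite /A' /A calT_eq0 ?mulr0.
    - by rewrite /A' /A P_out ?mulr0 ?mul0r //; rewrite /K; lia.
  have shiftB : \sum_(0 <= i < K.+1) B i%:Z = \sum_(0 <= i < K.+1) B'' i%:Z.
    rewrite -(@sum_shift K B''); first last.
    - by rewrite /B'' /B' /B P_out ?mulr0 ?mul0r //; rewrite /K; lia.
    - by rewrite /B'' /B' /B calT_eq0 ?mulr0.
    transitivity (\sum_(0 <= i < K.+1) B' i%:Z); last first.
      by apply: eq_bigr => i _; rewrite /B'' subrK.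
    rewrite -(@sum_shift K B').
    - by apply: eq_bigr => i _; rewrite /B' subrK.
    - by rewrite /B' /B calT_eq0 ?mulr0.
    - by rewrite /B' /B P_out ?mulr0 ?mul0r //; rewrite /K; lia.
  rewrite sumrB shiftA shiftB -sumrB mulr_sumr; apply: eq_bigr => i _.
  rewrite /A' /B'' /B' /A /B addrK.
  rewrite (_ : i%:Z + 1 + 1 - 2 = i%:Z); last lia.
  rewrite (_ : L - 1 - (i%:Z + 1) = L - 2 - i%:Z); last lia.
  rewrite (_ : L - (i%:Z + 1 + 1) = L - 2 - i%:Z); last lia.
  (* For L = 1 the Pascal rule may meet its exception, but then L - 2 - i < 0 and T vanishes. *)
  have [L_eq1|L_neq1] := eqVneq L 1.
    by rewrite calT_eq0 ?mulr0 ?subrr //; lia.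
  rewrite /P (gaussian_pascal_top (L + M - 1 - (i%:Z + 1))); last lia.
  rewrite (_ : L + M - 1 - (i%:Z + 1) - 1 = L - 2 + (M - 1) - i%:Z); last lia.
  rewrite (_ : L + M - 1 - (i%:Z + 1 + 1) = L - 2 + (M - 1) - i%:Z); last lia.
  rewrite (_ : L - 1 - 1 = L - 2); last lia.
  have -> : (i%:Z + 1 + 1) ^+ 2 + M *+ 2 - (i%:Z + 1 + 1) *+ 2 = (i%:Z + 1) ^+ 2 + M *+ 2 - 1 by ring.
  have e : h ^ ((i%:Z + 1) ^+ 2 + M *+ 2 - 1) * h ^ ((L + M - 1 - (i%:Z + 1) - (L - 1)) *+ 2)
     = h ^ (M *+ 4 - 2) * h ^ (i%:Z ^+ 2).
    by rewrite -!qhalfD; congr (h ^ _); ring.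
  by rewrite !mulrA -e; ring.
rewrite -ABC -big_split !mulr_sumr -!sumrB -big_split.
apply: eq_big_nat => /= n Hn.
have rT : _ := calT_rec_a0 n%:Z (L - n%:Z) b.
have {}rT := rT ltac:(lia).
move: n%:Z rT => i rT {Hn n}.
have pG : g (L + M - i) L = h ^ ((M - i) *+ 2) * P i + g (L + (M - 1) - i) L.
  by rewrite gaussian_pascal_top; [congr (h ^ _ * g _ _ + g _ _); lia | lia].
rewrite pG /A /B.
rewrite (_ : L - 1 + M - i = L + M - 1 - i); last lia.
rewrite (_ : L - 1 + (M - 1) + 1 - i = L + M - 1 - i); last lia.
rewrite subrK -/(P i).
rewrite (_ : L - 1 - i = L - i - 1); last lia.
have e0 : h ^ (i ^+ 2) * h ^ ((M - i) *+ 2) = h ^ (i ^+ 2 + M *+ 2 - i *+ 2).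
  by rewrite -!qhalfD; congr (h ^ _); ring.
have e1 : h ^ (M *+ 2) * h ^ (i ^+ 2) = h ^ (i ^+ 2 + M *+ 2 - i *+ 2) * h ^ (i *+ 2).
  by rewrite -!qhalfD; congr (h ^ _); ring.
have e2 : h ^ (M *+ 2 - 1) * h ^ ((i - 1) ^+ 2) = h ^ (i ^+ 2 + M *+ 2 - i *+ 2).
  by rewrite -!qhalfD; congr (h ^ _); ring.
have e3 : h ^ (i ^+ 2 + M *+ 2 - 1) = h ^ (i ^+ 2 + M *+ 2 - i *+ 2) * h ^ (i *+ 2 - 1).
  by rewrite -!qhalfD; congr (h ^ _); ring.
rewrite !mulrDr !mulrA e1 e2 e3 e0.
apply/eqP; rewrite -subr_eq0; apply/eqP; move/eqP: rT; rewrite -subr_eq0 => /eqP rT.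
transitivity (h ^ (i ^+ 2 + M *+ 2 - i *+ 2) * P i * 0); last by rewrite mulr0.
rewrite -[X in _ = _ * X]rT -e0; ring.
Qed.

(** * Recurrences for the right-hand side *)

(* The factor q^(b^2/2) of the theorem is included. *)
Definition calS_term (L M a b k : int) : qfield :=
  h ^ (b ^+ 2 + (k * (k + a + b)) *+ 2) * g (L + M - (a + b) - k *+ 2) M
  * g (M - a) k * g (M + a) (k + a + b).

Lemma calS_term_eq0 (L M a b k : int) :
  [|| k < 0, k + a + b < 0 | L < k] -> calS_term L M a b k = 0.
Proof.
move=> H; rewrite /calS_term.
have [Hk|Hk] := ltP k 0; first by rewrite (gaussian_eq0 (M - a)) ?Hk // mulr0 mul0r.
have [Hc|Hc] := ltP (k + a + b) 0; first by rewrite (gaussian_eq0 (M + a)) ?Hc // mulr0.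
by rewrite (gaussian_eq0 (L + M - (a + b) - k *+ 2)) ?mulr0 ?mul0r //; lia.
Qed.

Lemma calSE (L M a b : int) (K : nat) : L < K%:Z ->
  h ^ (b ^+ 2) * calS L M (a + b) b = \sum_(0 <= k < K) calS_term L M a b k%:Z.
Proof.
move=> LK.
have termE k : h ^ (b ^+ 2) * (q ^ (k * (k + (a + b))) * g (L + M - (a + b) - k *+ 2) M
    * g (M - (a + b) + b) k * g (M + (a + b) - b) (k + (a + b))) = calS_term L M a b k.
  rewrite /calS_term qhalfD q_exp !mulrA (addrA k).
  by congr (_ * g _ _ * g _ _); lia.
rewrite /calS (@sum0_extend _ K) //; first by rewrite mulr_sumr; apply: eq_bigr => k _.
move=> k Hk; apply: (mulfI (expfz_neq0 (b ^+ 2) qhalf_neq0)).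
by rewrite mulr0 termE calS_term_eq0 // Hk !orbT.
Qed.

Lemma calS_term_shift (L M a b : int) (K : nat) : L <= K%:Z ->
  \sum_(0 <= k < K.+1) calS_term (L - 1) M a b k%:Z
  = \sum_(0 <= k < K.+1) calS_term (L - 1) M a b (k%:Z - 1).
Proof.
by move=> LK; rewrite sum_shift // calS_term_eq0 //; lia.
Qed.

(** With Psi_a the product in x and y from the overview, this is the coefficient of x^L y^(a+b) in
    (1 + (x/y) q^(M-a-1/2)) Psi_(a+1) = (1 + xy q^(M+a+1/2)) Psi_a. The index k counts powers of
    x/y, so the term with that factor is shifted. *)
Lemma calS_step_a (L M a b : int) : 0 <= a -> a + 1 <= M ->
  h ^ (b *+ 2 - 1) * (h ^ ((b - 1) ^+ 2) * calS L M (a + 1 + (b - 1)) (b - 1))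
  + h ^ (M *+ 2 + b *+ 2) * (h ^ (b ^+ 2) * calS (L - 1) M (a + 1 + b) b)
  = h ^ (b ^+ 2) * calS L M (a + b) b
    + h ^ (M *+ 2 + 1) * (h ^ ((b - 1) ^+ 2) * calS (L - 1) M (a + (b - 1)) (b - 1)).
Proof.
move=> a0 aM; pose K := `|L|.+1.
rewrite !(@calSE _ _ _ _ K.+1); try (rewrite /K; lia).
rewrite (calS_term_shift L M (a + 1) b); last by rewrite /K; lia.
rewrite !mulr_sumr -!big_split; apply: eq_bigr => /= n _; move: n%:Z => k.
rewrite /calS_term; pose c := a + b.
rewrite (_ : k + (a + 1) + (b - 1) = k + c); last by rewrite /c; lia.
rewrite (_ : a + 1 + (b - 1) = c); last by rewrite /c; lia.
rewrite (_ : k - 1 + (a + 1) + b = k + c); last by rewrite /c; lia.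
rewrite (_ : L - 1 + M - (a + 1 + b) - (k - 1) *+ 2 = L + M - c - k *+ 2); last by rewrite /c; lia.
rewrite (_ : k + a + (b - 1) = k + c - 1); last by rewrite /c; lia.
rewrite (_ : L - 1 + M - (a + (b - 1)) - k *+ 2 = L + M - c - k *+ 2); last by rewrite /c; lia.
rewrite (_ : k + a + b = k + c); last by rewrite /c; lia.
rewrite -/c (_ : M - (a + 1) = M - a - 1); last by lia.
set C := g (L + M - c - k *+ 2) M.
rewrite (gaussian_pascal_top (M - a)); last lia.
rewrite (gaussian_pascal_top (M + (a + 1)) (k + c)); last lia.
rewrite (_ : M + (a + 1) - 1 = M + a); last lia.
have e1 : h ^ (b *+ 2 - 1) * h ^ ((b - 1) ^+ 2 + (k * (k + c)) *+ 2) = h ^ (b ^+ 2 + (k * (k + c)) *+ 2).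
  by rewrite -!qhalfD; congr (h ^ _); ring.
have e2 : h ^ (M *+ 2 + b *+ 2) * h ^ (b ^+ 2 + ((k - 1) * (k + c)) *+ 2)
   = h ^ (b ^+ 2 + (k * (k + c)) *+ 2) * h ^ ((M - a - k) *+ 2).
  by rewrite -!qhalfD; congr (h ^ _); rewrite /c; ring.
have e3 : h ^ (M *+ 2 + 1) * h ^ ((b - 1) ^+ 2 + (k * (k + c - 1)) *+ 2)
   = h ^ (b ^+ 2 + (k * (k + c)) *+ 2) * h ^ ((M + (a + 1) - (k + c)) *+ 2).
  by rewrite -!qhalfD; congr (h ^ _); rewrite /c; ring.
by rewrite !mulrA e1 e2 e3; ring.
Qed.

(** For a = 0, with Psi_M now indexed by M, compare coefficients of x^L y^b in (1 - x q^M) Psi_M =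
    (1 + (x/y) q^(M-1/2)) (1 + xy q^(M-1/2)) Psi_(M-1). *)
Lemma calS_rec_a0 (L M b : int) : 1 <= M ->
  h ^ (b ^+ 2) * calS L M (0 + b) b - h ^ (b ^+ 2) * calS L (M - 1) (0 + b) b
  - h ^ (M *+ 2) * (h ^ (b ^+ 2) * calS (L - 1) M (0 + b) b)
  = h ^ (M *+ 2 - 1) * (h ^ ((b - 1) ^+ 2) * calS (L - 1) (M - 1) (0 + (b - 1)) (b - 1)
      + h ^ ((b + 1) ^+ 2) * calS (L - 1) (M - 1) (0 + (b + 1)) (b + 1))
    + h ^ (M *+ 4 - 2) * (h ^ (b ^+ 2) * calS (L - 2) (M - 1) (0 + b) b).
Proof.
move=> M1; pose K := `|L|.+1.
rewrite !(@calSE _ _ _ _ K.+1); try (rewrite /K; lia).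
rewrite (calS_term_shift L (M - 1) 0 (b + 1)); last by rewrite /K; lia.
rewrite (_ : L - 2 = L - 1 - 1); last lia.
rewrite (calS_term_shift (L - 1) (M - 1) 0 b); last by rewrite /K; lia.
rewrite -big_split !mulr_sumr -!sumrB -big_split; apply: eq_bigr => /= n _; move: n%:Z => k.
rewrite /calS_term !(addr0, add0r, subr0).
rewrite (_ : k + (b - 1) = k + b - 1); last lia.
rewrite (_ : k - 1 + (b + 1) = k + b); last lia.
rewrite (_ : k - 1 + b = k + b - 1); last lia.
pose C := g (L + M - 1 - b - k *+ 2) (M - 1).
rewrite (_ : L - 1 + (M - 1) - (b - 1) - k *+ 2 = L + M - 1 - b - k *+ 2); last lia.
rewrite (_ : L - 1 + (M - 1) - (b + 1) - (k - 1) *+ 2 = L + M - 1 - b - k *+ 2); last lia.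
rewrite (_ : L - 1 - 1 + (M - 1) - b - (k - 1) *+ 2 = L + M - 1 - b - k *+ 2); last lia.
rewrite (_ : L + (M - 1) - b - k *+ 2 = L + M - 1 - b - k *+ 2); last lia.
rewrite (_ : L - 1 + M - b - k *+ 2 = L + M - 1 - b - k *+ 2); last lia.
rewrite (gaussian_pascal (L + M - b - k *+ 2)); last lia.
rewrite (_ : L + M - b - k *+ 2 - 1 = L + M - 1 - b - k *+ 2); last lia.
rewrite (gaussian_pascal_top M k); last lia.
rewrite (gaussian_pascal_top M (k + b)); last lia.
set E := h ^ (b ^+ 2 + (k * (k + b)) *+ 2).
have e1 : h ^ (M *+ 2 - 1) * h ^ ((b - 1) ^+ 2 + (k * (k + b - 1)) *+ 2) = E * h ^ ((M - (k + b)) *+ 2).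
  by rewrite -!qhalfD; congr (h ^ _); ring.
have e2 : h ^ (M *+ 2 - 1) * h ^ ((b + 1) ^+ 2 + ((k - 1) * (k + b)) *+ 2) = E * h ^ ((M - k) *+ 2).
  by rewrite -!qhalfD; congr (h ^ _); ring.
have e3 : h ^ (M *+ 4 - 2) * h ^ (b ^+ 2 + ((k - 1) * (k + b - 1)) *+ 2) = E * h ^ ((M - (k + b)) *+ 2) * h ^ ((M - k) *+ 2).
  by rewrite -!qhalfD; congr (h ^ _); ring.
by rewrite (mulrDr (h ^ (M *+ 2 - 1))) !mulrA e1 e2 e3; ring.
Qed.

(** * Vanishing ranges and initial values *)

Lemma calF_eq0 (L M a b : int) :
  [|| L < 0, M < 0, M < b, L < a + b | L < a] -> calF L M a b = 0.
Proof.
move=> H; rewrite (@calFE _ _ _ _ `|M|.+1); last lia.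
rewrite big1 // => i _.
have [Li|Li] := boolP ((L < 0) || (M < i%:Z)).
  by rewrite (gaussian_eq0 (L + M - i%:Z)) ?mulr0 ?mul0r //; lia.
rewrite calT_eq0 ?mulr0 //.
by lia.
Qed.

Lemma calS_eq0 (L M a b : int) :
  [|| L < 0, M < 0, M < b | L < a + b] -> calS L M (a + b) b = 0.
Proof.
move=> H; apply: (mulfI (expfz_neq0 (b ^+ 2) qhalf_neq0)).
rewrite mulr0 (@calSE _ _ _ _ `|L|.+1); last lia.
rewrite big1 // => k _; rewrite /calS_term.
have [Hk|Hk] := boolP ((L < 0) || (L < a + b) || (M < 0)).
  have [Hc|Hc] := boolP (k%:Z + a + b < 0).
    by rewrite (gaussian_eq0 (M + a)) ?Hc ?mulr0.
  by rewrite (gaussian_eq0 (L + M - (a + b) - k%:Z *+ 2)) ?mulr0 ?mul0r //; lia.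
have [Mk|Mk] := ltP (M - a) k%:Z.
  by rewrite (gaussian_eq0 (M - a)) ?mulr0 ?mul0r // Mk orbT.
by rewrite (gaussian_eq0 (M + a)) ?mulr0 //; lia.
Qed.

Lemma calT00 (N b : int) : 0 <= N -> calT 0 N b 0 = (b == 0)%:R.
Proof.
move=> N0; have [->|b0] := eqVneq b 0; last by rewrite calT_eq0 //; lia.
rewrite (@calTE _ _ _ _ 1) // big_nat1 /calT_term /cg !(addr0, subr0, mul0rn).
by rewrite !gaussianNN // gaussian0 // !mulr1.
Qed.

Lemma calF_M0 (L b : int) : 0 <= L -> calF L 0 0 b = (b == 0)%:R.
Proof.
move=> L0; rewrite (@calFE _ _ _ _ 1) // big_nat1 !(addr0, subr0).
by rewrite gaussianNN // calT00 // !mul1r.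
Qed.

Lemma calF_L0 (M b : int) : 0 <= M -> calF 0 M 0 b = (b == 0)%:R.
Proof.
move=> M0; rewrite (@calFE _ _ _ _ `|M|.+1); last lia.
rewrite big_nat_recl // big1 => [|i _]; last first.
  by rewrite calT_eq0 ?mulr0 //; lia.
by rewrite !(addr0, add0r, subr0) gaussian0 // calT00 // !mul1r.
Qed.

Lemma calS_M0 (L b : int) : 0 <= L -> h ^ (b ^+ 2) * calS L 0 (0 + b) b = (b == 0)%:R.
Proof.
move=> L0; rewrite (@calSE _ _ _ _ `|L|.+1); last lia.
rewrite big_nat_recl // big1 => [|k _]; last first.
  by rewrite /calS_term (gaussian_eq0 (0 - 0)) ?mulr0 ?mul0r.
rewrite /calS_term !(addr0, add0r, subr0, mul0rn, mul0r).
have [->|b0] := eqVneq b 0; last by rewrite (gaussian_eq0 0 b) ?mulr0 //; lia.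
by rewrite subr0 !gaussian0 // !mulr1.
Qed.

Lemma calS_L0 (M b : int) : 0 <= M -> h ^ (b ^+ 2) * calS 0 M (0 + b) b = (b == 0)%:R.
Proof.
move=> M0; rewrite (@calSE _ _ _ _ 1) // big_nat1.
rewrite /calS_term !(addr0, add0r, subr0, mul0rn, mul0r).
have [->|b0] := eqVneq b 0; first by rewrite subr0 !gaussian0 // gaussianNN // !mulr1.
have [b_neg|b_pos] := ltP b 0; first by rewrite (gaussian_eq0 M b) ?mulr0 ?b_neg.
by rewrite (gaussian_eq0 (M - b) M) ?mulr0 ?mul0r //; lia.
Qed.

(** * Induction for nonnegative a and b *)

Lemma calF_eq_calS_a0 (L M b : int) : calF L M 0 b = h ^ (b ^+ 2) * calS L M (0 + b) b.
Proof.
have [M_neg|] := ltP M 0; first by rewrite calF_eq0 ?calS_eq0 ?mulr0 ?M_neg ?orbT.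
case: M => // M _; elim: M L b => [|M IHM] L b;
  (have [L_neg|] := ltP L 0; first by rewrite calF_eq0 ?calS_eq0 ?mulr0 ?L_neg);
  case: L => // L _; first by rewrite calF_M0 ?calS_M0.
elim: L => [|L IHL]; first by rewrite calF_L0 ?calS_L0.
have M1 : 1 <= M.+1%:Z by [].
have L1 : 1 <= L.+1%:Z by [].
have {}IHM l c : calF l (M.+1%:Z - 1) 0 c = h ^ (c ^+ 2) * calS l (M.+1%:Z - 1) (0 + c) c.
  by have -> : M.+1%:Z - 1 = M%:Z by lia.
have {}IHL : calF (L.+1%:Z - 1) M.+1 0 b = h ^ (b ^+ 2) * calS (L.+1%:Z - 1) M.+1 (0 + b) b.
  by have -> : L.+1%:Z - 1 = L%:Z by lia.
move: (M.+1%:Z) (L.+1%:Z) M1 L1 IHM IHL => m l m1 l1 IHM IHL.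
(* After the induction hypotheses are substituted, the two recurrences differ only in their leading
   term. *)
have rF := @calF_rec_a0 l m b l1 m1; have rS := @calS_rec_a0 l m b m1.
rewrite !IHM IHL -rS in rF.
by move: rF => /addIr /addIr.
Qed.

(** In the step recurrence the leading term has a + 1. The others have a, covered by the outer
    induction on a, or L - 1, covered by the inner induction on L with b left free. At L = 0 both
    sides vanish as soon as a > 0. *)
Lemma calF_eq_calS (L M a b : int) : 0 <= a -> 0 <= b -> a <= M ->
  calF L M a b = h ^ (b ^+ 2) * calS L M (a + b) b.
Proof.
case: a => // a _; elim: a L b => [|a IHa] L b b0 aM; first exact: calF_eq_calS_a0.
have [L_neg|] := ltP L 0; first by rewrite calF_eq0 ?calS_eq0 ?mulr0 ?L_neg.
case: L => // L _; elim: L b b0 => [|L IHL'] b b0.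
  by rewrite calF_eq0 ?calS_eq0 ?mulr0 //; lia.
have {}IHL c : 0 <= c ->
    calF (L.+1%:Z - 1) M (a%:Z + 1) c = h ^ (c ^+ 2) * calS (L.+1%:Z - 1) M (a%:Z + 1 + c) c.
  have -> : L.+1%:Z - 1 = L%:Z by lia.
  have -> : a%:Z + 1 = a.+1%:Z by lia.
  exact: IHL'.
have -> : a.+1%:Z = a%:Z + 1 by lia.
have {aM}aM : a%:Z + 1 <= M by lia.
have L1 : 1 <= L.+1%:Z by [].
move: (L.+1%:Z) L1 IHL => l l1 IHL.
(* The recurrences are used at b + 1, which meets their bound b >= 1 and puts the leading term at (a
   + 1, b). *)
have rF := @calF_step_a l M a (b + 1) isT ltac:(lia) l1.
have rS := @calS_step_a l M a (b + 1) isT aM.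
rewrite addrK in rF rS.
rewrite IHL ?IHa in rF; try lia.
apply: (mulfI (expfz_neq0 ((b + 1) *+ 2 - 1) qhalf_neq0)).
by move: rF; rewrite -rS => /addIr.
Qed.

(** * The symmetry (a,b) -> (-a,-b) and the conclusion *)

Lemma calT_opp (L M a b : int) : calT L M (- a) (- b) = calT L M a b.
Proof.
rewrite /calT; case: L => //= l; apply: eq_bigr => n _.
rewrite !opprK (_ : (2 %| n%:Z - a + l%:Z)%Z = (2 %| n%:Z + a + l%:Z)%Z); last lia.
by case: ifP => // _; rewrite mulrAC.
Qed.

Lemma calF_opp (L M a b : int) : calF L M (- a) (- b) = calF L M a b.
Proof. by rewrite /calF; case: M => //= m; apply: eq_bigr => i _; rewrite calT_opp. Qed.

(** On the left the terms with k < a + b vanish. Replacing k by k + a + b in the rest swaps the last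
    two Gaussian factors and preserves the exponent. *)
Lemma calS_opp (L M a b : int) : 0 <= a -> 0 <= b ->
  calS L M (- a - b) (- b) = calS L M (a + b) b.
Proof.
move=> a0 b0; apply: (mulfI (expfz_neq0 (b ^+ 2) qhalf_neq0)).
pose K := `|L|.+1; pose c := absz (a + b).
rewrite -{1}sqrrN !(@calSE _ _ _ _ (c + K)%N); try (rewrite /K /c; lia).
rewrite (@big_cat_nat _ _ _ c) //=; last (rewrite /K /c; lia).
rewrite big_nat big1 ?add0r => [|k Hk]; last by rewrite calS_term_eq0 //; move: Hk; rewrite /c; lia.
rewrite -{1}[c]add0n big_addn addKn.
rewrite [RHS](@big_cat_nat _ _ _ K) //=; last (rewrite /K /c; lia).
rewrite [X in _ = _ + X]big_nat [X in _ = _ + X]big1 ?addr0 => [|k Hk]; last first.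
  by rewrite calS_term_eq0 //; move: Hk; rewrite /K /c; lia.
apply: eq_bigr => k _; rewrite /calS_term sqrrN !opprK.
rewrite (_ : (k + c)%N%:Z = k%:Z + a + b); last (rewrite /K /c; lia).
rewrite -!mulrA; congr (h ^ _ * (g _ _ * _)); [ring|rewrite /c; lia|].
by rewrite mulrC; congr (g _ _ * g _ _); (rewrite /K /c; lia).
Qed.

Theorem theorem2p2 (L M a b : int)
  (hab : 0 <= a * b)
  (hbound : `|b| <= M -> `|a + b| <= L -> `|a| <= M) :
  sum0 M (fun i =>
    qhalf ^ (i ^+ 2) * gaussian (L + M - i) L * calT i (L - i) b a)
  = qhalf ^ (b ^+ 2) * calS L M (a + b) b.
Proof.
rewrite -/(calF L M a b).
(* Since ab >= 0, either a and b or their negatives are both nonnegative. *)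
wlog [a0 b0] : a b hab hbound / 0 <= a /\ 0 <= b => [IH|].
  have [[a0 b0]|H] : (0 <= a /\ 0 <= b) \/ (0 <= - a /\ 0 <= - b).
    have [a_pos|a_neg|a0] := ltrgt0P a; last by lia.
    - by left; split=> //; move: hab; rewrite pmulr_rge0.
    - by right; split; [lia | move: hab; rewrite nmulr_rge0 // oppr_ge0].
  - exact: IH.
  have [a0 b0] := H.
  have := IH (- a) (- b) _ _ H.
  rewrite calF_opp sqrrN -(calS_opp L M (- a) (- b)) // !opprK; apply.
    by rewrite mulrNN.
  by rewrite -opprD !normrN.
(* Both sides vanish unless b <= M and a + b <= L, and in that range [hbound] supplies a <= M. *)
have [Mb|bM] := ltP M b; first by rewrite calF_eq0 ?calS_eq0 ?mulr0 ?Mb ?orbT.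
have [Lc|cL] := ltP L (a + b); first by rewrite calF_eq0 ?calS_eq0 ?mulr0 ?Lc ?orbT.
by apply: calF_eq_calS => //; lia.
Qed.
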